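(* Let $$L_n=n\int_{[0,1]^d}\Big(C_n(\mathbf{u})-\prod_{j=1}^d u_j\Big)^2\prod_{j=1}^d (1-u_j)^2\,d\mathbf{u}.$$ Then $$L_n=\sum_{i=1}^n\left[\frac1n\sum_{l=1}^n\prod_{j=1}^d 3^{-1}\big(1-\hat U_{i,j}\vee\hat U_{l,j}\big)^3-2\prod_{j=1}^d\left(\frac1{12}-\frac14\hat U_{i,j}^4+\frac23\hat U_{i,j}^3-\frac12\hat U_{i,j}^2\right)\right]+n\,30^{-d}.$$
   Context: Let $d\ge2$ and let $(X_{i,1},\dots,X_{i,d})$, $i=1,\dots,n$, be a sample of $n$ observations in $\mathbb{R}^d$. With $\mathbb{I}$ the indicator function, set $\hat F_j(x)=\frac1n\sum_{i=1}^n\mathbb{I}(X_{i,j}\le x)$, $\hat U_{i,j}=\hat F_j(X_{i,j})$, and let the empirical copula be $$C_n(\mathbf{u})=\frac1n\sum_{i=1}^n\prod_{j=1}^d\mathbb{I}(\hat U_{i,j}\le u_j),\qquad\mathbf{u}\in[0,1]^d.$$ Write $a\vee b=\max(a,b)$; in particular $1-\hat U_{i,j}\vee\hat U_{l,j}$ means $1-\max(\hat U_{i,j},\hat U_{l,j})$. *)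

(* Defs.v *)
(* MathComp / MathComp-Analysis, over an abstract R : realType. *)
From HB Require Import structures.
From mathcomp Require Import all_boot all_order all_algebra.
From mathcomp Require Import all_classical all_reals all_analysis.

Set Implicit Arguments.
Unset Strict Implicit.
Unset Printing Implicit Defensive.
Import Order.TTheory GRing.Theory Num.Theory.
Import numFieldNormedType.Exports.
Local Open Scope classical_set_scope.
Local Open Scope ring_scope.

(* Lebesgue measure on R^d is built by recursion on d: the product of the
   one-dimensional Lebesgue measure with the measure on R^(d-1), transported
   to the product sigma-algebra of d.-tuple R along (x, t) |-> x :: t. *)
Section lebesgue_tuple_succ.
Context {R : realType} (d : nat).
Local Notation mR := (measurableTypeR R).
Variable mu : {sigma_finite_measure set (d.-tuple mR) -> \bar R}.

Definition tuple_cons (p : mR * d.-tuple mR) : d.+1.-tuple mR :=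
  [the d.+1.-tuple mR of p.1 :: p.2].

Definition tuple_uncons (t : d.+1.-tuple mR) : mR * d.-tuple mR :=
  (tnth t ord0, [tuple of behead t]).

Lemma tuple_consK : cancel tuple_cons tuple_uncons.
Proof. by move=> [x t]; congr pair; exact: val_inj. Qed.

Lemma measurable_tuple_cons : measurable_fun [set: mR * d.-tuple mR] tuple_cons.
Proof. exact: (measurable_cons measurable_fst measurable_snd). Qed.

Lemma measurable_tuple_uncons : measurable_fun [set: d.+1.-tuple mR] tuple_uncons.
Proof.
by apply: measurable_fun_pair; [exact: measurable_tnth|exact: measurable_behead].
Qed.

Definition lebesgue_tuple_succ : set (d.+1.-tuple mR) -> \bar R :=
  pushforward (@lebesgue_measure R \x mu)%E tuple_cons.

HB.instance Definition _ := Measure.copy lebesgue_tuple_succ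
  (@measure_function_pushforward__canonical__measure_function_Measure
    _ _ _ _ _ _ _ measurable_tuple_cons).

Let sigma_finite_lebesgue_tuple_succ : sigma_finite setT lebesgue_tuple_succ.
Proof.
have /sigma_finiteP[F [TF ndF Foo]] := sigma_finiteT (@lebesgue_measure R).
have /sigma_finiteP[G [TG ndG Goo]] := sigma_finiteT mu.
have uncons_pre k : tuple_cons @^-1` (tuple_uncons @^-1` (F k `*` G k)) =
    F k `*` G k.
  by rewrite -comp_preimage (_ : _ \o _ = id)//; apply/funext => p; exact: tuple_consK.
exists (fun k => tuple_uncons @^-1` (F k `*` G k)).
  apply/esym/seteqP; split=> // t _.
  have [k _ Fk] : (\bigcup_k F k) (tnth t ord0) by rewrite -TF.
  have [l _ Gl] : (\bigcup_k G k) [tuple of behead t] by rewrite -TG.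
  exists (maxn k l) => //; split => /=.
  - by move: Fk; exact/subsetPset/ndF/leq_maxl.
  - by move: Gl; exact/subsetPset/ndG/leq_maxr.
move=> k; have [mF Fk] := Foo k; have [mG Gk] := Goo k; split.
  rewrite -[X in measurable X]setTI; apply: measurable_tuple_uncons => //.
  exact: measurableX.
rewrite /lebesgue_tuple_succ /pushforward uncons_pre.
by rewrite product_measure1E// lte_mul_pinfty// ge0_fin_numE.
Qed.

HB.instance Definition _ := @Measure_isSigmaFinite.Build _ _ _
  lebesgue_tuple_succ sigma_finite_lebesgue_tuple_succ.
End lebesgue_tuple_succ.

Fixpoint lebesgue_tuple (R : realType) (d : nat) :
    {sigma_finite_measure set (d.-tuple (measurableTypeR R)) -> \bar R} :=
  match d with
  | 0 => \d_([tuple] : 0.-tuple (measurableTypeR R))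
  | d'.+1 => lebesgue_tuple_succ (lebesgue_tuple R d')
  end.

Lemma lebesgue_tuple_box (R : realType) (d : nat)
    (A : 'I_d -> set (measurableTypeR R)) :
  (forall j, measurable (A j)) ->
  lebesgue_tuple R d [set u | forall j, A j (tnth u j)] =
  (\prod_(j < d) lebesgue_measure (A j))%E.
Proof.
elim: d A => [|d IHd] A mA /=.
  by rewrite big_ord0 diracE mem_set// => -[].
rewrite /lebesgue_tuple_succ /pushforward big_ord_recl.
rewrite (_ : _ @^-1` _ =
    A ord0 `*` [set u | forall j, A (lift ord0 j) (tnth u j)]); last first.
  apply/seteqP; split => -[x t] /= => [H|[H0 H] j].
    by split => [|j]; [exact: (H ord0)|have := H (lift ord0 j); rewrite tnthS].
  by have [j' ->|-> //] := unliftP ord0 j; rewrite tnthS.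
rewrite product_measure1E//; first by rewrite (IHd (fun j => A (lift ord0 j))).
rewrite (_ : [set _ | _] = \bigcap_(j in [set: 'I_d])
    ((fun u : d.-tuple (measurableTypeR R) => tnth u j) @^-1` A (lift ord0 j)));
  last by apply/seteqP; split => u /= H j => [_|]; exact: H.
apply: fin_bigcap_measurable => [|j _]; first exact: finite_finset.
by rewrite -[X in measurable X]setTI; exact: measurable_tnth.
Qed.

Section empirical_copula.
Context {R : realType} {n d : nat}.

(* X i j is the j-th coordinate of the i-th observation. *)
Variable X : 'I_n -> 'I_d -> R.

(* Here and below, a boolean condition b enters as its indicator b%:R. *)
Definition ecdf (j : 'I_d) (x : R) : R :=
  n%:R^-1 * \sum_(i < n) (X i j <= x)%R%:R.

Definition pseudo_obs (i : 'I_n) (j : 'I_d) : R := ecdf j (X i j).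

Definition empirical_copula (u : d.-tuple R) : R :=
  n%:R^-1 * \sum_(i < n) \prod_(j < d) (pseudo_obs i j <= tnth u j)%R%:R.

Definition unit_cube : set (d.-tuple R) :=
  [set u | forall j, 0 <= tnth u j <= 1].

Definition Ln : R :=
  n%:R * \int[lebesgue_tuple R d]_(u in unit_cube)
    ((empirical_copula u - \prod_(j < d) tnth u j) ^+ 2
     * \prod_(j < d) (1 - tnth u j) ^+ 2).

End empirical_copula.

(* Main.v *)
Require Import Defs.
From HB Require Import structures.
From mathcomp Require Import all_boot all_order all_algebra.
From mathcomp Require Import all_classical all_reals all_analysis.
From mathcomp Require Import measurable_realfun ring.
Import Order.TTheory GRing.Theory Num.Theory.
Import numFieldNormedType.Exports.
Local Open Scope ring_scope.

(** With [W(u) = prod_j (1 - u_j)^2] and [P(u) = prod_j u_j], expanding the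
    square turns the integrand into a linear combination of three kinds of
    terms (lemma [weighted_square_expansion]):
    - [n^-2] times the sum over pairs [(i, l)] of the weighted orthant indicators
      [W(u) prod_j I(max(U_ij, U_lj) <= u_j)], because
      [I(a <= x) I(b <= x) = I(max(a, b) <= x)];
    - [-2/n] times the sum over [i] of [P(u) W(u) prod_j I(U_ij <= u_j)];
    - [P(u)^2 W(u)].
    Each of them is a product over [j] of one-variable functions of the form
    [I(a_j <= x) x^k (1 - x)^2], with [k = 0], [1] and [2] respectively (and
    [a_j = 0] in the last case). By Tonelli, the integral over the cube of such
    a product is the product of the integrals over [[0, 1]]
    ([integral_unit_cube_prod]), and these follow from the fundamental theorem
    of calculus applied to a polynomial primitive ([integral_tail_moment]).

    The three closed forms [tail_moment0], [tail_moment1] and [tail_moment2_0]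
    then give the three parts of the formula. Since an integral of a sum splits
    only for integrable summands, the value of each term is carried together
    with its integrability by [has_integral]. *)

(** * Product functions on the unit cube *)

(** Tonelli on a rectangle: extending [f] and [g] by zero outside [A] and [B]
    keeps the integrand a product on the whole product space. *)
Lemma ge0_integral_prodM (d1 d2 : measure_display) (T1 : measurableType d1)
    (T2 : measurableType d2) (R : realType)
    (m1 : {sigma_finite_measure set T1 -> \bar R})
    (m2 : {sigma_finite_measure set T2 -> \bar R})
    (A : set T1) (B : set T2) (f : T1 -> \bar R) (g : T2 -> \bar R) :
  measurable A -> measurable B -> measurable_fun A f -> measurable_fun B g ->
  (forall x, A x -> 0 <= f x)%E -> (forall y, B y -> 0 <= g y)%E ->
  (\int[m1 \x m2]_(z in A `*` B) (f z.1 * g z.2) =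
   \int[m1]_(x in A) f x * \int[m2]_(y in B) g y)%E.
Proof.
move=> mA mB mf mg f0 g0; rewrite integral_mkcond.
have -> : ((fun z : T1 * T2 => f z.1 * g z.2) \_ (A `*` B) =
    fun z => (f \_ A) z.1 * (g \_ B) z.2)%E.
  apply/funext => -[x y]; rewrite !patchE in_setX /=.
  by case: (x \in A); case: (y \in B); rewrite ?mule0 ?mul0e.
have mfA : measurable_fun setT (f \_ A) by apply/(measurable_restrictT _ mA).
have mgB : measurable_fun setT (g \_ B) by apply/(measurable_restrictT _ mB).
have fA0 x : (0 <= (f \_ A) x)%E by exact: erestrict_ge0.
have gB0 y : (0 <= (g \_ B) y)%E by exact: erestrict_ge0.
rewrite fubini_tonelli1; last 2 first.
- by apply: emeasurable_funM; apply: measurableT_comp.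
- by move=> z; rewrite mule_ge0.
rewrite [in RHS]integral_mkcond [in RHS](integral_mkcond B).
rewrite -ge0_integralZr//; last exact: integral_ge0.
by apply: eq_integral => x _; rewrite /fubini_F /= ge0_integralZl.
Qed.

Lemma measurable_unit_cube (R : realType) (d : nat) :
  measurable (unit_cube : set (d.-tuple (measurableTypeR R))).
Proof.
rewrite (_ : unit_cube = (\bigcap_(j in [set: 'I_d])
    ((fun u : d.-tuple (measurableTypeR R) => tnth u j) @^-1` `[0, 1]))%classic).
  apply: fin_bigcap_measurable => [|j _]; first exact: finite_finset.
  by rewrite -[X in measurable X]setTI; exact: measurable_tnth.
by apply/seteqP; split => u /= H j => [_|]; have := H j; rewrite /= in_itv /=; exact.
Qed.

Lemma measurable_prod_tnth (R : realType) (d : nat)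
    (f : 'I_d -> measurableTypeR R -> R) :
  (forall j, measurable_fun setT (f j)) ->
  measurable_fun setT (fun u : d.-tuple (measurableTypeR R) =>
    \prod_(j < d) f j (tnth u j)).
Proof.
move=> mf; apply: measurable_prod => j _.
by apply: (measurableT_comp (mf j)); exact: measurable_tnth.
Qed.

(** By induction on [d], peeling off the first coordinate: the measure on
    [d.+1]-tuples is the image of a product measure under [tuple_cons], and the
    cube pulls back to the rectangle [[0, 1]] times the [d]-dimensional cube.
    Nonnegativity lets Tonelli apply without any prior integrability. *)
Lemma integral_unit_cube_prod (R : realType) (d : nat)
    (f : 'I_d -> measurableTypeR R -> R) :
  (forall j, measurable_fun setT (f j)) ->
  (forall j x, 0 <= x <= 1 -> 0 <= f j x) ->
  (\int[lebesgue_tuple R d]_(u in unit_cube) (\prod_(j < d) f j (tnth u j))%:E =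
   \prod_(j < d) \int[@lebesgue_measure R]_(x in `[0%R, 1%R]) (f j x)%:E)%E.
Proof.
have mprod k (h : 'I_k -> measurableTypeR R -> R) D :
    (forall j, measurable_fun setT (h j)) ->
    measurable_fun D (fun u : k.-tuple (measurableTypeR R) =>
      (\prod_(j < k) h j (tnth u j))%:E).
  by move=> mh; apply/measurable_funTS/measurable_EFinP; exact: measurable_prod_tnth.
elim: d f => [|d IHd] f mf f0.
  rewrite big_ord0 /= integral_dirac//.
  - rewrite diracE mem_set; last by case.
    by rewrite big_ord0 mule1.
  - exact: measurable_unit_cube.
  - exact: (mprod 0%N f).
rewrite big_ord_recl -IHd//; last by move=> j x; exact: f0.
rewrite -ge0_integral_prodM//=; last 5 first.
- exact: measurable_unit_cube.
- by apply/measurable_funTS/measurable_EFinP.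
- exact: (mprod d (fun j => f (lift ord0 j))).
- by move=> x; rewrite /= in_itv/= => x01; rewrite lee_fin f0.
- by move=> u cu; rewrite lee_fin prodr_ge0// => j _; exact/f0/cu.
rewrite /lebesgue_tuple_succ ge0_integral_pushforward//; last 4 first.
- exact: measurable_tuple_cons.
- exact: measurable_unit_cube.
- exact: (mprod d.+1 f).
- by move=> u /[!inE] cu; rewrite lee_fin prodr_ge0// => j _; exact/f0/cu.
rewrite (_ : _ @^-1` _ = `[0, 1]%classic `*` unit_cube)%classic; last first.
  apply/seteqP; split => -[x t] /= => [H|[H0 H] j].
    split => [|j]; first by have := H ord0; rewrite in_itv.
    by have := H (lift ord0 j); rewrite tnthS.
  have [j' ->|->] := unliftP ord0 j; first by rewrite tnthS; exact: H.
  by move: H0; rewrite in_itv.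
apply: eq_integral => -[x t] _ /=.
rewrite big_ord_recl EFinM; congr (_ * _%:E)%E.
by apply: eq_bigr => j _; rewrite tnthS.
Qed.

(** * One-dimensional integrals of [x^k (1 - x)^2] *)

(** Termwise primitive of [x^k (1 - x)^2 = x^k - 2 x^(k+1) + x^(k+2)]. *)
Definition weight_primitive (R : realType) (k : nat) : {poly R} :=
  k.+1%:R^-1 *: 'X^(k.+1) - (2 / k.+2%:R) *: 'X^(k.+2) + k.+3%:R^-1 *: 'X^(k.+3).

Lemma deriv_weight_primitive (R : realType) (k : nat) (x : R) :
  (weight_primitive R k)^`().[x] = x ^+ k * (1 - x) ^+ 2.
Proof.
rewrite !(derivD, derivN, derivZ, derivXn).
rewrite !(hornerMn, hornerXn, hornerZ, hornerN, hornerD) /=.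
rewrite -!(mulr_natr (x ^+ _)).
have h m : m.+1%:R != 0 :> R by rewrite pnatr_eq0.
have e m y : m.+1%:R^-1 * (y * m.+1%:R) = y :> R by rewrite mulrC mulfK.
by rewrite -(mulrA 2) !e !exprS; ring.
Qed.

(** The integral of [x^k (1 - x)^2] over [[a, 1]], see [integral_tail_moment]. *)
Definition tail_moment (R : realType) (k : nat) (a : R) : R :=
  (weight_primitive R k).[1] - (weight_primitive R k).[a].

Arguments tail_moment {R}.

Lemma tail_moment0 (R : realType) (a : R) :
  tail_moment 0 a = 3^-1 * (1 - a) ^+ 3.
Proof. by rewrite /tail_moment /weight_primitive !hornerE /= ?expr1n; field. Qed.

Lemma tail_moment1 (R : realType) (a : R) :
  tail_moment 1 a = 12^-1 - 4^-1 * a ^+ 4 + 2 / 3 * a ^+ 3 - 2^-1 * a ^+ 2.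
Proof. by rewrite /tail_moment /weight_primitive !hornerE /= ?expr1n; field. Qed.

Lemma tail_moment2_0 (R : realType) : tail_moment 2 (0 : R) = 30^-1.
Proof.
by rewrite /tail_moment /weight_primitive !hornerE /= ?expr1n ?expr0n /=; field.
Qed.

(** The indicator cuts the domain down to [[a, 1]], where the fundamental theorem
    of calculus applies. *)
Lemma integral_tail_moment (R : realType) (k : nat) (a : R) : 0 <= a <= 1 ->
  (\int[@lebesgue_measure R]_(x in `[0%R, 1%R])
     ((a <= x)%R%:R * (x ^+ k * (1 - x) ^+ 2))%:E = (tail_moment k a)%:E)%E.
Proof.
move=> /andP[a0 a1].
transitivity (\int[@lebesgue_measure R]_(x in `[a, 1%R])
    ((weight_primitive R k)^`().[x])%:E)%E.
  rewrite integral_mkcond [RHS]integral_mkcond; apply: eq_integral => x _.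
  rewrite !patchE !mem_setE !in_itv /= deriv_weight_primitive.
  have [ax|xa] := leP a x; first by rewrite (le_trans a0 ax) mul1r.
  by rewrite mul0r; case: ifP.
(* The fundamental theorem asks for a < 1; for a = 1 both sides vanish. *)
move: a1; rewrite le_eqVlt => /predU1P[->|a1].
  by rewrite set_itv1 integral_set1 /tail_moment subrr.
rewrite (@continuous_FTC2 _ _ (horner (weight_primitive R k)))//.
- by apply: continuous_subspaceT => x; exact: continuous_horner.
- split=> [x _||]; first exact: derivable_horner.
  + by apply: cvg_at_right_filter; exact: continuous_horner.
  + by apply: cvg_at_left_filter; exact: continuous_horner.
- by move=> x _; rewrite derivE.
Qed.

(** * Linear combinations of integrable functions *)

Section has_integral.
Context {R : realType} {disp : measure_display} {T : measurableType disp}.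
Variables (mu : {measure set T -> \bar R}) (D : set T).
Hypothesis mD : measurable D.

(** The real-valued integral is total and additive only on integrable functions,
    so both facts travel together through linear combinations. *)
Definition has_integral (f : T -> R) (c : R) :=
  mu.-integrable D (EFin \o f) /\ \int[mu]_(x in D) f x = c.

Lemma has_integralD f g a b : has_integral f a -> has_integral g b ->
  has_integral (fun x => f x + g x) (a + b).
Proof.
move=> [fi <-] [gi <-]; split; last exact: RintegralD.
exact: (integrableD mD fi gi).
Qed.

Lemma has_integralZ r f a : has_integral f a ->
  has_integral (fun x => r * f x) (r * a).
Proof.
move=> [fi <-]; split; last exact: RintegralZl.
exact: (integrableZl mD r fi).
Qed.

Lemma has_integral_sum n (f : 'I_n -> T -> R) (a : 'I_n -> R) :
  (forall i, has_integral (f i) (a i)) ->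
  has_integral (fun x => \sum_(i < n) f i x) (\sum_(i < n) a i).
Proof.
elim: n f a => [|n IHn] f a h.
  rewrite big_ord0; under eq_fun do rewrite big_ord0.
  by split; [exact: integrable0|rewrite Rintegral_cst// mul0r].
rewrite big_ord_recl; under eq_fun do rewrite big_ord_recl.
by apply: has_integralD; [exact: h|apply: IHn => i; exact: h].
Qed.

Lemma eq_has_integral f g a : {in D, f =1 g} -> has_integral f a ->
  has_integral g a.
Proof.
move=> fg [fi <-]; split; last by apply/esym/eq_Rintegral.
by apply: eq_integrable fi => // x xD /=; rewrite fg.
Qed.

End has_integral.

Arguments has_integralD {R disp T mu D} mD {f g a b}.
Arguments has_integralZ {R disp T mu D} mD r {f a}.
Arguments has_integral_sum {R disp T mu D} mD {n f a}.
Arguments eq_has_integral {R disp T mu D} mD {f g a}.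

(** * Weighted orthant indicators *)

(** The common shape of all terms of the expanded integrand. Integrability comes
    for free, the function being nonnegative with a finite integral. *)
Lemma has_integral_tail_moments (R : realType) (d k : nat) (a : 'I_d -> R) :
  (forall j, 0 <= a j <= 1) ->
  has_integral (lebesgue_tuple R d) unit_cube
    (fun u => \prod_(j < d) ((a j <= tnth u j)%R%:R *
                             (tnth u j ^+ k * (1 - tnth u j) ^+ 2)))
    (\prod_(j < d) tail_moment k (a j)).
Proof.
move=> a01.
pose f (j : 'I_d) (x : measurableTypeR R) : R :=
  (a j <= x)%R%:R * (x ^+ k * (1 - x) ^+ 2).
have mf j : measurable_fun setT (f j).
  apply: measurable_funM.
    apply: (measurableT_comp (f := fun b : bool => b%:R : R)) => //.
    exact: measurable_fun_ler.
  apply: measurable_funM; apply: measurable_funX => //.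
  exact: measurable_funB.
have f0 j x : 0 <= x <= 1 -> 0 <= f j x.
  move=> /andP[x0 _]; apply: mulr_ge0 => //; apply: mulr_ge0.
    exact: exprn_ge0.
  exact: sqr_ge0.
have intf : (\int[lebesgue_tuple R d]_(u in unit_cube)
    (\prod_(j < d) f j (tnth u j))%:E = (\prod_(j < d) tail_moment k (a j))%:E)%E.
  rewrite integral_unit_cube_prod// -prodEFin.
  by apply: eq_bigr => j _; rewrite integral_tail_moment.
split; last by rewrite /Rintegral intf.
apply/integrableP; split.
  by apply/measurable_funTS/measurable_EFinP; exact: (measurable_prod_tnth R d f).
rewrite (eq_integral (fun u => (\prod_(j < d) f j (tnth u j))%:E)).
  by rewrite intf ltry.
move=> u /[!inE] cu /=; rewrite ger0_norm//.
by apply: prodr_ge0 => j _; exact/f0/cu.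
Qed.

Arguments has_integral_tail_moments {R d} k {a}.

(** * The empirical copula *)

Lemma pseudo_obs01 (R : realType) (n d : nat) (X : 'I_n -> 'I_d -> R) i j :
  0 <= pseudo_obs X i j <= 1.
Proof.
case: n X i => [X []//|n] X i; rewrite /pseudo_obs /ecdf mulr_ge0 ?sumr_ge0//=.
rewrite ler_pdivrMl ?ltr0n// mulr1 -[leRHS](_ : \sum_(i < n.+1) 1 = _).
  by apply: ler_sum => l _; rewrite lern1 leq_b1.
by rewrite sumr_const card_ord.
Qed.

Arguments pseudo_obs01 {R n d} X i j.

(** In the products of one-variable factors, the neutral factor [x ^+ 0] and, on
    the cube, the indicator of [0 <= x] bring all three kinds of terms to the
    shape of [has_integral_tail_moments]. *)
Lemma weighted_square_expansion (R : realType) (n d : nat)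
    (X : 'I_n -> 'I_d -> R) (u : d.-tuple R) : unit_cube u ->
  (empirical_copula X u - \prod_(j < d) tnth u j) ^+ 2
    * \prod_(j < d) (1 - tnth u j) ^+ 2 =
  n%:R^-1 * (n%:R^-1 * \sum_(i < n) \sum_(l < n) \prod_(j < d)
      ((Num.max (pseudo_obs X i j) (pseudo_obs X l j) <= tnth u j)%R%:R *
       (tnth u j ^+ 0 * (1 - tnth u j) ^+ 2)))
  + (- (2 * n%:R^-1) * \sum_(i < n) \prod_(j < d)
      ((pseudo_obs X i j <= tnth u j)%R%:R *
       (tnth u j ^+ 1 * (1 - tnth u j) ^+ 2))
  + \prod_(j < d) ((0 <= tnth u j)%R%:R * (tnth u j ^+ 2 * (1 - tnth u j) ^+ 2))).
Proof.
move=> cu.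
pose T i := \prod_(j < d) (pseudo_obs X i j <= tnth u j)%R%:R : R.
pose P := \prod_(j < d) tnth u j; pose W := \prod_(j < d) (1 - tnth u j) ^+ 2.
have -> : \sum_(i < n) \sum_(l < n) \prod_(j < d)
    ((Num.max (pseudo_obs X i j) (pseudo_obs X l j) <= tnth u j)%R%:R *
     (tnth u j ^+ 0 * (1 - tnth u j) ^+ 2)) = (\sum_(i < n) T i) ^+ 2 * W.
  rewrite expr2 !mulr_suml; apply: eq_bigr => i _.
  rewrite mulr_sumr mulr_suml; apply: eq_bigr => l _.
  rewrite /T /W -!big_split; apply: eq_bigr => j _ /=.
  by rewrite ge_max -mulnb natrM expr0 mul1r.
have -> : \sum_(i < n) \prod_(j < d) ((pseudo_obs X i j <= tnth u j)%R%:R *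
    (tnth u j ^+ 1 * (1 - tnth u j) ^+ 2)) = (\sum_(i < n) T i) * P * W.
  rewrite !mulr_suml; apply: eq_bigr => i _.
  by rewrite /T /P /W -!big_split; apply: eq_bigr => j _ /=; rewrite expr1 mulrA.
have -> : \prod_(j < d) ((0 <= tnth u j)%R%:R *
    (tnth u j ^+ 2 * (1 - tnth u j) ^+ 2)) = P ^+ 2 * W.
  rewrite /P /W expr2 -!big_split; apply: eq_bigr => j _ /=.
  by have /andP[-> _] := cu j; rewrite mul1r -expr2.
by rewrite /empirical_copula -/P -/W; ring.
Qed.

Arguments weighted_square_expansion {R n d} X {u}.

Theorem proposition7 (R : realType) (n d : nat) (X : 'I_n -> 'I_d -> R)
    (n_gt0 : (0 < n)%N) (d_ge2 : (2 <= d)%N) :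
  Ln X =
  \sum_(i < n)
    (n%:R^-1 * (\sum_(l < n) \prod_(j < d)
        (3^-1 * (1 - Num.max (pseudo_obs X i j) (pseudo_obs X l j)) ^+ 3))
     - 2 * \prod_(j < d)
        (12^-1 - 4^-1 * pseudo_obs X i j ^+ 4
         + 2 / 3 * pseudo_obs X i j ^+ 3
         - 2^-1 * pseudo_obs X i j ^+ 2))
  + n%:R * 30 ^- d.
Proof.
have n0 : n%:R != 0 :> R by rewrite pnatr_eq0 -lt0n.
have mcube := measurable_unit_cube R d.
have max01 i l j : 0 <= Num.max (pseudo_obs X i j) (pseudo_obs X l j) <= 1.
  by case: (leP (pseudo_obs X i j) (pseudo_obs X l j)) => _; exact: pseudo_obs01.
have pairs i := has_integral_sum mcube (fun l =>
  has_integral_tail_moments 0 (max01 i l)).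
have cross := has_integral_sum mcube (fun i =>
  has_integral_tail_moments 1 (pseudo_obs01 X i)).
have square := has_integral_tail_moments 2
  (fun _ : 'I_d => introT andP (conj (lexx 0) (@ler01 R))).
have [_ intE] := eq_has_integral mcube
  (fun u cu => esym (weighted_square_expansion X (set_mem cu)))
  (has_integralD mcube
    (has_integralZ mcube n%:R^-1
      (has_integralZ mcube n%:R^-1 (has_integral_sum mcube pairs)))
    (has_integralD mcube (has_integralZ mcube (- (2 * n%:R^-1)) cross) square)).
rewrite /Ln intE tail_moment2_0 prodr_const card_ord exprVn.
rewrite sumrB -!mulr_sumr.
under eq_bigr do under eq_bigr do under eq_bigr do rewrite tail_moment0.
under [X in - (2 * n%:R^-1) * X]eq_bigr do
  under eq_bigr do rewrite tail_moment1.
by move: (\sum_(i < n) _) (\sum_(i < n) _) (30 ^- d) => B A V; field.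
Qed.
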